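(* Let $L,R>0$. There exist a finite family $\mathcal{F}$ of convex functions on the $L^\infty$-ball $B_\infty(0,R)=[-R,R]^n\subset\mathbb{R}^n$ that are Lipschitz-continuous with Lipschitz constant $L$ in the $L^\infty$ norm, and a single-coordinate local oracle $\tilde{\mathcal{O}}$ for $\mathcal{F}$, such that both the distributional and the high-probability oracle complexity for finding an $\varepsilon$-minimum of a uniformly random instance of $\mathcal F$ are $\Omega\left(n\log\frac{LR}{\varepsilon}\right)$. For bounded-error algorithms with error bound $P_e$, the distributional complexity is $\Omega\left((1-P_e)\,n\log\frac{LR}{\varepsilon}\right)$, and the high-probability complexity is $\Omega\left(n\log\frac{LR}{\varepsilon}\right)$.
   Context: The family and the oracle may depend on $n,\varepsilon,L,R$. For $f:X\to\mathbb{R}$ with $f^*=\min_X f$, an $\varepsilon$-minimum is a point $x\in X$ with $f(x)<f^*+\varepsilon$. $\log$ is the binary logarithm. An oracle $\mathcal{O}$ for a family $\mathcal{F}$ of functions on $X$ returns for an instance $f\in\mathcal{F}$ and a query $x\in X$ an answer $\mathcal{O}_f(x)$. It is local if $\mathcal{O}_{f_1}(x)=\mathcal{O}_{f_2}(x)$ whenever $f_1,f_2\in\mathcal{F}$ are equal in a neighborhood of $x$. It is first-order if $\mathcal{O}_f(x)=(f(x),g)$ with $g\in\partial f(x)$ a subgradient. A first-order oracle is single-coordinate if for all $x$ the returned subgradient has the form $\lambda e_i$ ($\lambda\in\mathbb{R}$, $e_i$ the $i$-th standard coordinate vector) with $i$ the smallest index for which a subgradient of $f$ at $x$ of this form exists.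 An algorithm knows $\mathcal{F}$ and the instance distribution but accesses the instance only by adaptive oracle queries; it stops and outputs a point of $X$. $T$ denotes its number of queries. The error bound is $P_e$ if the output is an $\varepsilon$-minimum with probability at least $1-P_e$ (over the random instance and any private randomness); $P_e=0$ if no error bound is mentioned. The asymptotic statements mean: there is a universal constant $c>0$ such that every algorithm with error bound $P_e$ satisfies $\mathbb{E}[T]\ge c(1-P_e)n\log\frac{LR}{\varepsilon}$ (distributional complexity) and $\mathbb{P}[T\ge c\,n\log\frac{LR}{\varepsilon}]\ge 1-P_e-o(1)$ (high-probability complexity), asymptotically as $n\log\frac{LR}{\varepsilon}\to\infty$ with $LR/\varepsilon$ at least a universal constant and $P_e\in[0,1)$ fixed. *)

(* Defs.v *)
From HB Require Import structures.
From mathcomp Require Export all_boot all_order all_algebra.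
From mathcomp Require Export all_classical all_reals all_analysis.
Export Order.TTheory GRing.Theory Num.Theory.
Export numFieldNormedType.Exports.

Set Implicit Arguments.
Unset Strict Implicit.
Unset Printing Implicit Defensive.

Local Open Scope classical_set_scope.
Local Open Scope ring_scope.

Definition log2 {R : realType} (x : R) : R := ln x / ln 2.

(* The library norm on 'rV[R]_n is the maximum norm, and the topology it
   induces is the usual one. *)
Definition box {R : realType} (n : nat) (r : R) : set 'rV[R]_n :=
  [set x | `|x| <= r].
Arguments box {R} n r _.

Section functions.
Context {R : realType} {n : nat}.
Local Notation V := 'rV[R]_n.
Implicit Types (X : set V) (f : V -> R) (x g : V).

(* Functions on X are represented by total functions; all the notions below
   only depend on their values on X. *)

Definition eps_minimum X f (e : R) x : Prop :=
  X x /\ exists y, [/\ X y, forall z, X z -> f y <= f z & f x < f y + e].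

Definition subgradient X f x g : Prop :=
  forall y, X y -> f x + \sum_(i < n) g 0 i * (y 0 i - x 0 i) <= f y.

Definition coordinate_subgradient X f x (i : 'I_n) (a : R) : Prop :=
  subgradient X f x (a *: delta_mx 0 i).

End functions.

Section oracles.
Context {R : realType} {n : nat} {I : Type}.
Local Notation V := 'rV[R]_n.
Implicit Types (X : set V) (F : I -> V -> R).

(* Neighbourhoods are taken in X, where the functions live. *)
Definition local_oracle {B : Type} X F (O : I -> V -> B) : Prop :=
  forall i j x, X x ->
    (\forall y \near within X (nbhs x), F i y = F j y) -> O i x = O j x.

Definition first_order_oracle X F (O : I -> V -> R * V) : Prop :=
  forall i x, X x -> (O i x).1 = F i x /\ subgradient X (F i) x (O i x).2.

Definition single_coordinate_oracle X F (O : I -> V -> R * V) : Prop :=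
  first_order_oracle X F O /\
  forall i x, X x -> exists (k : 'I_n) (a : R),
    (O i x).2 = a *: delta_mx 0 k /\
    forall (l : 'I_n) (b : R),
      coordinate_subgradient X (F i) x l b -> (k <= l)%N.

(* A family, i.e. a set, of functions on X, listed without repetition. *)
Definition distinct_on X F : Prop :=
  forall i j : I, (forall x, X x -> F i x = F j x) -> i = j.

End oracles.

Section algorithms.
Context {V B : Type}.

Variant action := Query of V | Output of V.

Definition point (a : action) : V :=
  match a with Query x => x | Output x => x end.

(* [run s O h t x]: with strategy [s], a function of the answers received so
   far, and oracle [O], after the answers [h] exactly [t] more queries are made,
   and then [x] is output. *)
Inductive run (s : seq B -> action) (O : V -> B) : seq B -> nat -> V -> Prop :=
| run_output h x : s h = Output x -> run s O h 0 x
| run_query h x t y :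
    s h = Query x -> run s O (rcons h (O x)) t y -> run s O h t.+1 y.

End algorithms.
Arguments action V : clear implicits.

(* [w : Om] is the private randomness, independent of the instance. Almost
   surely, for every instance i, the algorithm stops, after [queries i w]
   queries, with output [output i w]. *)
Record algorithm {R : realType} {V B I : Type} (X : set V) (O : I -> V -> B)
    {d : measure_display} {Om : measurableType d} (P : probability Om R) := {
  strategy : Om -> seq B -> action V;
  strategy_in : forall w h, X (point (strategy w h));
  queries : I -> Om -> nat;
  output : I -> Om -> V;
  runP : forall i, {ae P, forall w,
    run (strategy w) (O i) [::] (queries i w) (output i w)};
  measurable_queries : forall i, measurable_fun setT (queries i)
}.

Section complexity.
Context {R : realType} {I : finType}.
Local Open Scope ereal_scope.

(* Expectation over a uniformly random instance. *)
Definition uniform_mean (a : I -> \bar R) : \bar R :=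
  (#|I|%:R^-1)%:E * \sum_(i : I) a i.

Context {n : nat} {B : Type} {X : set 'rV[R]_n} {O : I -> 'rV[R]_n -> B}.
Context {d : measure_display} {Om : measurableType d} {P : probability Om R}.
Variable A : algorithm X O P.

Definition success (F : I -> 'rV[R]_n -> R) (e : R) (i : I) : set Om :=
  [set w | eps_minimum X (F i) e (output A i w)].

Definition error_bound (F : I -> 'rV[R]_n -> R) (e Pe : R) : Prop :=
  (forall i, measurable (success F e i)) /\
  (1 - Pe)%:E <= uniform_mean (fun i => P (success F e i)).

Definition expected_queries : \bar R :=
  uniform_mean (fun i => \int[P]_w ((queries A i w)%:R)%:E).

Definition prob_queries_ge (t : R) : \bar R :=
  uniform_mean (fun i => P [set w | (t <= (queries A i w)%:R)%R]).

End complexity.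

(* Main.v *)
Require Import Defs.
From mathcomp Require Import measurable_realfun ring lra zify.

(** Instances are [n]-tuples of bit strings of length [M ~ log_16 (L r / e)], and
    the function of an instance is the maximum over the coordinates of convex
    functions of one variable. The one-dimensional function of a string is built by
    self-similar refinement of [|x|]: its first [m] bits determine it above a height
    [kappa m], and two strings with different first [m] bits are never both below a
    height [theta m > kappa m], at any point. The gap between [theta M] and the
    minimal values exceeds [e], so an [e]-minimum determines the instance.

    The oracle reports the value, the first active coordinate and a slope. Once some
    prefix of every string is known, let [U] be the largest value still possible at
    the query point and [c] the first coordinate where it is possible. If the next
    bit of the string of [c] agrees with a maximiser, the answer is determined,
    because [U >= theta] exceeds [kappa]. Hence a query is a guess of a bit string
    that only reveals the position of the first error, in an order chosen by the
    query. Giving the weight [(3/2)^f] to a set of instances with [f] unknown bits,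
    the weights of the pieces into which a query splits it sum to at most three times
    its own weight, so [T] queries can solve at most [3^T (3/2)^(n M)] of the
    [2^(n M)] instances. *)

Set Implicit Arguments.
Unset Strict Implicit.
Unset Printing Implicit Defensive.

Local Open Scope classical_set_scope.
Local Open Scope ring_scope.

(** * Bent functions of one variable *)

Section one_dimensional.
Context {R : realType}.
Implicit Types (s t : seq bool) (x y a : R) (m : nat) (b : bool).

(** The affine map onto [[-1/2, 1/2]] from [[1/4, 1/2]] for [true], from [[-1/2, -1/4]] for
    [false]. *)
Definition zoom b x : R := 4 * x + (if b then - (3 / 2) else 3 / 2).

(* The lowest point of [bend s'] lies in [-1/2, 1/2], which [zoom b] maps back into
   the half of [-1/2, 1/2] selected by [b], where [|x| <= 2^-1] leaves the copy
   [2^-1 + 16^-1 * bend s'] intact. *)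
Fixpoint bend s x : R :=
  if s is b :: s' then Num.max `|x| (2^-1 + 16^-1 * bend s' (zoom b x)) else `|x|.

Fixpoint level a m : R := if m is m'.+1 then 2^-1 + 16^-1 * level a m' else a.

(* The critical heights of the [m]-th refinement are [level 0 m], [level 1 m] and
   [level (3 / 2) m]; [8 / 15] is the fixed point of the recursion. *)
Lemma levelB a a' m : level a m - level a' m = (a - a') / 16 ^+ m.
Proof.
elim: m => [|m IH] /=; first by rewrite expr0 divr1.
rewrite exprS invfM mulrCA -IH; lra.
Qed.

Lemma level_ge a m : 8 / 15 <= a -> 8 / 15 <= level a m.
Proof. by move=> a8; elim: m => [//|m IH] /=; lra. Qed.

Lemma level_le a m : a <= 8 / 15 -> level a m <= 8 / 15.
Proof. by move=> a8; elim: m => [//|m IH] /=; lra. Qed.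

Lemma level_ge0 a m : 0 <= a -> 0 <= level a m.
Proof. by move=> a0; elim: m => [//|m IH] /=; lra. Qed.

Lemma level_lt a a' m : a < a' -> level a m < level a' m.
Proof. by move=> aa'; elim: m => [//|m IH] /=; lra. Qed.

Lemma level_le_init m : level (3 / 2) m <= 3 / 2.
Proof. by elim: m => [//|m IH] /=; lra. Qed.

Lemma norm_le_bend s x : `|x| <= bend s x.
Proof. by case: s => //= b s; rewrite le_max lexx. Qed.

Lemma zoom_norm b x : `|zoom b x| <= 4 * `|x| + 3 / 2.
Proof.
have := ler_norm x; have := ler_norm (- x); rewrite normrN => h1 h2.
by rewrite /zoom ler_norml; case: b; apply/andP; split; lra.
Qed.

(** By [zoom_norm] the refinement stays below [|x|] outside [[-1, 1]]. Hence above height 1 all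
    strings give the same function. *)
Lemma bend_le s x : bend s x <= Num.max `|x| 1.
Proof.
elim: s x => [|b s IH] x /=; first by rewrite le_max lexx.
rewrite ge_max le_max lexx /= le_max.
move: (IH (zoom b x)) (zoom_norm b x); rewrite le_max.
case: (lerP `|x| 1) => x1; case/orP => h1 h2; apply/orP; lra.
Qed.

(** Cutting off below a height commutes with increasing affine maps and with the maximum with [|x|],
    so equality for the tails passes up one level. *)
Lemma bend_prefix m s t x :
    (m <= size s)%N -> (m <= size t)%N -> take m s = take m t ->
  Num.max (bend s x) (level 1 m) = Num.max (bend t x) (level 1 m).
Proof.
elim: m s t x => [|m IH] s t x /=.
  move=> _ _ _.
  have bend0 u : Num.max (bend u x) 1 = Num.max `|x| 1.
    apply/eqP; rewrite eq_le !ge_max bend_le !le_max lexx norm_le_bend.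
    by rewrite !orbT.
  by rewrite !bend0.
case: s t => [|b s] [|b' t] //= ms mt [<- st].
have := IH s t (zoom b x) ms mt st.
set u := bend s _; set v := bend t _; set k := level _ _ => uv.
suff h w : Num.max (Num.max `|x| (2^-1 + 16^-1 * w)) (2^-1 + 16^-1 * k) =
    Num.max `|x| (2^-1 + 16^-1 * Num.max w k) by rewrite !h uv.
rewrite -maxA; congr (Num.max _ _).
case: (leP w k) => wk.
- by apply/max_idPr; lra.
- by apply/max_idPl; lra.
Qed.

(** At the first differing bit, one of the strings selects the side of 0 away from [x]. There
    [|zoom b x| >= 3/2], which bounds its value from below. *)
Lemma bend_split m s t x :
    (m <= size s)%N -> (m <= size t)%N -> take m s <> take m t ->
  level (3 / 2) m <= Num.max (bend s x) (bend t x).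
Proof.
elim: m s t x => [|m IH] s t x /=; first by rewrite !take0.
have half b u : (if b then x <= 0 else 0 <= x) ->
    2^-1 + 16^-1 * level (3 / 2) m <= bend (b :: u) x.
  move=> bx /=; rewrite le_max; apply/orP; right.
  have := level_le_init m; have := norm_le_bend u (zoom b x).
  have := ler_norm (zoom b x); have := ler_norm (- zoom b x); rewrite normrN.
  have : zoom b x = 4 * x + (if b then - (3 / 2) else 3 / 2) by [].
  by move: (zoom b x) => z; case: b bx => ?; lra.
case: s t => [|b s] [|b' t] // ms mt.
have [<-|bb' _] := eqVneq b b'.
  move=> st; have {}st : take m s <> take m t.
    by move=> e; apply: st; rewrite /= e.
  have := IH s t (zoom b x) ms mt st.
  by rewrite /= !le_max => /orP[?|?]; apply/orP; [left|right];
    apply/orP; right; lra.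
rewrite le_max; apply/orP.
clear ms mt; have [x0|x0] := lerP x 0; case: b b' bb' => -[] // _.
- by left; apply: (half true).
- by right; apply: (half true).
- by right; apply: (half false); apply: ltW.
- by left; apply: (half false); apply: ltW.
Qed.

Lemma bend_low s : exists2 y, `|y| <= 2^-1 & bend s y <= level 0 (size s).
Proof.
elim: s => [|b s [y y2 ys]] /=; first by exists 0; rewrite ?normr0 ?invr_ge0.
move: (y2); rewrite ler_norml => /andP[y2a y2b].
(* The preimage of [y] under [zoom b]. *)
exists (4^-1 * (y - (if b then - (3 / 2) else 3 / 2))).
  by rewrite ler_norml; case: b; apply/andP; split; lra.
rewrite (_ : zoom b _ = y) ?ge_max; last by rewrite /zoom; case: b; lra.
have := normr_ge0 y; have := norm_le_bend s y => ? ?.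
apply/andP; split; last lra.
by rewrite ler_norml; case: b; apply/andP; split; lra.
Qed.

Lemma bend_convex s (t x y : R) : 0 <= t <= 1 ->
  bend s (t * x + (1 - t) * y) <= t * bend s x + (1 - t) * bend s y.
Proof.
move=> t01.
have normc u v : `|t * u + (1 - t) * v| <= t * `|u| + (1 - t) * `|v|.
  have [t0 t1] : 0 <= t /\ 0 <= 1 - t by split; lra.
  by apply: le_trans (ler_normD _ _) _; rewrite !normrM (ger0_norm t0) (ger0_norm t1).
elim: s x y => [|b s IH] x y /=; first exact: normc.
have monoc (u v p q : R) : u <= p -> v <= q ->
    t * u + (1 - t) * v <= t * p + (1 - t) * q.
  by move=> up vq; apply: lerD; apply: ler_wpM2l => //; lra.
rewrite ge_max; apply/andP; split.
  by apply: le_trans (normc _ _) _; apply: monoc; rewrite le_max lexx.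
rewrite (_ : zoom b _ = t * zoom b x + (1 - t) * zoom b y); last first.
  by rewrite /zoom; ring.
have mx (u v : R) : v <= Num.max u v by rewrite le_max lexx orbT.
apply: le_trans (monoc _ _ _ _ (mx _ _) (mx _ _)).
by have := IH (zoom b x) (zoom b y); lra.
Qed.

(** [zoom] multiplies slopes by 4 and [16^-1] leaves at most [1/4], less than the slope of [|x|]. *)
Lemma bend_lipschitz s x y : `|bend s x - bend s y| <= `|x - y|.
Proof.
suff h u v : bend s u <= bend s v + `|u - v|.
  rewrite ler_norml; apply/andP; split; last by have := h x y; lra.
  by have := h y x; rewrite distrC; lra.
elim: s u v => [|b s IH] u v /=.
  by rewrite addrC -lerBlDr lerB_dist.
rewrite ge_max; apply/andP; split.
  apply: le_trans (_ : `|v| + `|u - v| <= _).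
    by rewrite addrC -lerBlDr lerB_dist.
  by rewrite lerD2r le_max lexx.
apply: le_trans (_ : (2^-1 + 16^-1 * bend s (zoom b v)) + `|u - v| <= _).
  have := IH (zoom b u) (zoom b v).
  rewrite (_ : zoom b u - zoom b v = 4 * (u - v)); last by rewrite /zoom; ring.
  by rewrite normrM ger0_norm//; have := normr_ge0 (u - v); lra.
by rewrite lerD2r le_max lexx orbT.
Qed.

Lemma bend_subgradient s x : exists a, forall y, bend s x + a * (y - x) <= bend s y.
Proof.
elim: s x => [|b s IH] x /=.
  have [x0|x0] := lerP 0 x; [exists 1|exists (-1)] => y.
    by rewrite mul1r (ger0_norm x0); have := ler_norm y; lra.
  by rewrite (ltr0_norm x0); have := ler_norm (- y); rewrite normrN; lra.
case: leP => [_|_]; last first.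
  have [x0|x0] := lerP 0 x; [exists 1|exists (-1)] => y; rewrite le_max;
    apply/orP; left.
    by rewrite mul1r (ger0_norm x0); have := ler_norm y; lra.
  by rewrite (ltr0_norm x0); have := ler_norm (- y); rewrite normrN; lra.
have [a ha] := IH (zoom b x).
exists (4^-1 * a) => y; rewrite le_max; apply/orP; right.
have := ha (zoom b y).
rewrite (_ : zoom b y - zoom b x = 4 * (y - x)); last by rewrite /zoom; ring.
lra.
Qed.

End one_dimensional.

(** * The family *)

Section row_vectors.
Context {R : realType} {n : nat}.
Implicit Types (x y g : 'rV[R]_n) (X : set 'rV[R]_n) (f : 'rV[R]_n -> R).

Lemma row_norm_le x a : 0 <= a -> (forall c, `|x 0 c| <= a) -> `|x| <= a.
Proof.
move=> a0 xa; rewrite /Num.norm /= mx_normrE; apply: bigmax_le => // -[i c] _ /=.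
by rewrite ord1.
Qed.

Lemma coord_norm_le x c : `|x 0 c| <= `|x|.
Proof.
rewrite [leRHS]/Num.norm /= mx_normrE.
exact: (le_bigmax 0 (fun ij : 'I_1 * 'I_n => `|x ij.1 ij.2|) (0, c)).
Qed.

Lemma coordinate_subgradientP X f x k a :
  coordinate_subgradient X f x k a <->
  forall y, X y -> f x + a * (y 0 k - x 0 k) <= f y.
Proof.
have E y : \sum_(i < n) (a *: delta_mx 0 k : 'rV_n) 0 i * (y 0 i - x 0 i) =
    a * (y 0 k - x 0 k).
  rewrite (bigD1 k) //= big1 => [|i ik]; first by rewrite !mxE !eqxx mulr1 addr0.
  by rewrite !mxE eqxx (negbTE ik) mulr0 mul0r.
by split => H y /H; rewrite E.
Qed.

Lemma box_convex (r t : R) x y : box n r x -> box n r y -> 0 <= t <= 1 ->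
  box n r (t *: x + (1 - t) *: y).
Proof.
rewrite /box /= => xr yr /andP[t0 t1].
apply: le_trans (ler_normD _ _) _; rewrite !normrZ !ger0_norm ?subr_ge0//.
have := ler_wpM2l t0 xr; have : (1 - t) * `|y| <= (1 - t) * r.
  by apply: ler_wpM2l => //; lra.
lra.
Qed.

Lemma convex_functionE X f x y (t : R) :
    convex_function X f -> X x -> X y -> 0 <= t <= 1 ->
  f (t *: x + (1 - t) *: y) <= t * f x + (1 - t) * f y.
Proof.
move=> cf Xx Xy /andP[t0 t1].
by have := cf (Itv01 t0 t1) x y; rewrite !inE => /(_ Xx Xy).
Qed.

(** The inequality holds for [f'] near [x], and convexity of [f'] extends it along the segment to
    any [y]. *)
Lemma subgradient_local X f f' x g :
    (forall y t, X y -> 0 <= t <= 1 -> X (t *: y + (1 - t) *: x)) ->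
    convex_function X f' -> X x ->
    (\forall y \near within X (nbhs x), f y = f' y) ->
  subgradient X f x g -> subgradient X f' x g.
Proof.
move=> cX cf' Xx ff' fg y Xy.
have fx : f x = f' x by apply: (nbhs_singleton ff').
case/nbhs_ballP: ff' => e /= e0 ball_ff'.
(* Positive, at most 1, and small enough to put [z] into the ball of radius [e], also for
   [y = x]. *)
pose t := e / (e + `|y - x|).
have d0 : 0 <= `|y - x| by [].
have ed0 : 0 < e + `|y - x| by lra.
have t0 : 0 < t by rewrite divr_gt0.
have t1 : 0 <= t <= 1 by rewrite ltW //= ler_pdivrMr // mul1r lerDl.
pose z := t *: y + (1 - t) *: x.
have zx : z - x = t *: (y - x).
  by apply/rowP => c; rewrite !mxE; ring.
have Xz : X z by exact: cX.
have fz : f z = f' z.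
  apply: ball_ff' => //; rewrite -ball_normE /= distrC zx normrZ gtr0_norm //.
  rewrite /t mulrAC ltr_pdivrMr // mulrDr; have := mulr_gt0 e0 e0; lra.
have := fg z Xz; rewrite fz.
have -> : \sum_(i < n) g 0 i * (z 0 i - x 0 i) =
    t * \sum_(i < n) g 0 i * (y 0 i - x 0 i).
  rewrite mulr_sumr; apply: eq_bigr => i _; rewrite mulrCA; congr (_ * _).
  by have := congr1 (fun u : 'rV_n => u 0 i) zx; rewrite !mxE.
have := convex_functionE cf' Xy Xx t1; rewrite -/z fx => h1 h2.
by rewrite -(ler_pM2l t0); lra.
Qed.

End row_vectors.

Section family.
Context {R : realType} {n M : nat} (L r : R).
Hypotheses (L0 : 0 < L) (r0 : 0 < r).
Implicit Types (s : seq bool) (i j : {ffun 'I_n -> M.-tuple bool}).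
Implicit Types (x y : 'rV[R]_n) (c k l : 'I_n).

(** [bend] has Lipschitz constant 1, so this scaling has constant [L]. *)
Definition piece s (u : R) : R := L * r * bend s (u / r).

Definition height a m : R := L * r * level a m.

Definition family i x : R := \big[Num.max/0]_(c < n) piece (i c) (x 0 c).

Let K0 : 0 < L * r. Proof. exact: mulr_gt0. Qed.

Lemma piece_ge0 s u : 0 <= piece s u.
Proof. by rewrite mulr_ge0 ?(ltW K0) //; apply: le_trans (norm_le_bend _ _). Qed.

Lemma piece_prefix m s s' u :
    (m <= size s)%N -> (m <= size s')%N -> take m s = take m s' ->
  Num.max (piece s u) (height 1 m) = Num.max (piece s' u) (height 1 m).
Proof.
by move=> *; rewrite /piece /height -!maxr_pMr ?(ltW K0) // (@bend_prefix _ m s s').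
Qed.

Lemma piece_split m s s' u :
    (m <= size s)%N -> (m <= size s')%N -> take m s <> take m s' ->
  height (3 / 2) m <= Num.max (piece s u) (piece s' u).
Proof.
by move=> *; rewrite /piece -maxr_pMr ?(ltW K0) // ler_pM2l // bend_split.
Qed.

(** Iterates from [0] never exceed the fixed point [8/15], while those from [3/2] stay strictly
    above it, whatever the depths. *)
Lemma height_mu m m' : height 0 m < height (3 / 2) m'.
Proof.
rewrite ltr_pM2l //; apply: (@lt_le_trans _ _ (8 / 15 + 16^-1 ^+ m' / 2)).
  have := @level_le R 0 m; have : 0 < (16^-1 : R) ^+ m' by rewrite exprn_gt0.
  lra.
have := levelB (3 / 2 : R) (8 / 15) m'.
have := @level_ge R (8 / 15) m' (lexx _); rewrite -exprVn.
have : 0 < (16^-1 : R) ^+ m' by rewrite exprn_gt0.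
lra.
Qed.

Lemma piece_convex s (t u v : R) : 0 <= t <= 1 ->
  piece s (t * u + (1 - t) * v) <= t * piece s u + (1 - t) * piece s v.
Proof.
move=> t01; rewrite /piece [X in bend s X](_ : _ = t * (u / r) + (1 - t) * (v / r)).
  rewrite !(mulrCA _ (L * r)) -mulrDr ler_pM2l //; exact: bend_convex.
by ring.
Qed.

Lemma piece_lipschitz s (u v : R) : `|piece s u - piece s v| <= L * `|u - v|.
Proof.
rewrite -mulrBr normrM (gtr0_norm K0) -mulrA ler_pM2l //.
apply: le_trans (ler_wpM2l (ltW r0) (bend_lipschitz _ _ _)) _.
rewrite -mulrBl normrM (@gtr0_norm _ r^-1) ?invr_gt0 //.
by rewrite mulrCA mulfV ?mulr1 // gt_eqF.
Qed.

Lemma piece_subgradient s u :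
  exists a, forall v, piece s u + a * (v - u) <= piece s v.
Proof.
have [a ha] := bend_subgradient s (u / r); exists (L * a) => v.
have := ha (v / r); rewrite -(ler_pM2l K0) /piece mulrDr.
suff -> : L * r * (a * (v / r - u / r)) = L * a * (v - u) by [].
by field; rewrite gt_eqF.
Qed.

Lemma piece_le_family i x c : piece (i c) (x 0 c) <= family i x.
Proof. exact: (le_bigmax 0 (fun c => piece (i c) (x 0 c))). Qed.

Lemma family_le i x m : 0 <= m ->
  (forall c, piece (i c) (x 0 c) <= m) -> family i x <= m.
Proof. by move=> m0 h; apply: bigmax_le. Qed.

Lemma family_eq i x c :
  (forall l, piece (i l) (x 0 l) <= piece (i c) (x 0 c)) ->
  family i x = piece (i c) (x 0 c).
Proof.
move=> h; apply/eqP; rewrite eq_le piece_le_family andbT.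
by apply: family_le => //; apply: piece_ge0.
Qed.

Lemma family_attained i x : (0 < n)%N ->
  exists c, family i x = piece (i c) (x 0 c).
Proof.
move=> n0; have [c _ e] := @eq_bigmax _ R _ 0 (Ordinal n0) xpredT
  (fun c => piece (i c) (x 0 c)) isT (fun c _ => piece_ge0 _ _).
by exists c; exact: e.
Qed.

(** Each piece depends on its own coordinate alone, so all can be minimised at one point. *)
Lemma family_low i : exists2 y, box n r y &
  forall c, piece (i c) (y 0 c) <= height 0 M.
Proof.
have H c : exists u, `|u| <= r /\ piece (i c) u <= height 0 M.
  have [u u2 hu] := bend_low (i c) (R := R).
  exists (u * r); split.
    rewrite normrM (gtr0_norm r0) -[leRHS]mul1r ler_pM2r //.
    by apply: le_trans u2 _; lra.
  rewrite /piece mulfK ?gt_eqF // ler_pM2l //.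
  by rewrite size_tuple in hu.
have [y hy] := choice H.
exists (\row_c y c) => [|c]; last by rewrite mxE; have [] := hy c.
by apply: row_norm_le => [|c]; [exact: ltW|rewrite mxE; have [] := hy c].
Qed.

Lemma family_convex i : convex_function (box n r) (family i).
Proof.
move=> p x y _ _; set t := p%:num.
have t01 : 0 <= t <= 1 by apply/andP; split; rewrite /t.
have avg0 (u v : R) : 0 <= u -> 0 <= v -> 0 <= t * u + (1 - t) * v.
  by case/andP: t01 => ? ? *; rewrite addr_ge0 ?mulr_ge0 ?subr_ge0.
have avg_le (u v u' v' : R) : u <= u' -> v <= v' ->
    t * u + (1 - t) * v <= t * u' + (1 - t) * v'.
  by case/andP: t01 => ? ? *; rewrite lerD ?ler_wpM2l ?subr_ge0.
have f0 z : 0 <= family i z by apply: bigmax_ge_id.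
apply: family_le => [|c]; first exact: avg0.
have -> : (conv p x y : 'rV_n) 0 c = t * x 0 c + (1 - t) * y 0 c by rewrite !mxE.
apply: le_trans (piece_convex _ _ _ t01) _.
by apply: avg_le; apply: piece_le_family.
Qed.

Lemma family_lipschitz i x y : `|family i x - family i y| <= L * `|x - y|.
Proof.
suff h u v : family i u <= family i v + L * `|u - v|.
  rewrite ler_norml; apply/andP; split; last by have := h x y; lra.
  by have := h y x; rewrite distrC; lra.
have f0 : 0 <= family i v by apply: bigmax_ge_id.
apply: family_le => [|c]; first by rewrite addr_ge0 // mulr_ge0 // ltW.
have := piece_lipschitz (i c) (u 0 c) (v 0 c); rewrite ler_norml => /andP[_ h].
have := piece_le_family i v c; have := coord_norm_le (u - v) c; rewrite !mxE.
by rewrite -(ler_pM2l L0); lra.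
Qed.

Lemma family_split i j x : i <> j ->
  height (3 / 2) M <= Num.max (family i x) (family j x).
Proof.
move=> ij; have [c ijc] : exists c, i c <> j c.
  by apply: contrapT => h; apply: ij; apply/ffunP => c; apply: contrapT => ijc;
    apply: h; exists c.
apply: le_trans (@piece_split M (i c) (j c) (x 0 c) _ _ _) _;
  rewrite ?size_tuple //.
  by rewrite !take_oversize ?size_tuple // => /val_inj.
by rewrite ge_max !le_max !piece_le_family orbT.
Qed.

(** Two equal functions would both be low at a minimiser, against [family_split]. *)
Lemma family_distinct : distinct_on (box n r) family.
Proof.
move=> i j ij; apply: contrapT => /family_split h.
have [y Xy hy] := family_low i; have := h y; rewrite -ij // maxxx.
have := height_mu M M; have : family i y <= height 0 M.
  by apply: family_le => //; rewrite mulr_ge0 ?(ltW K0) // level_ge0.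
lra.
Qed.

End family.

(** * The single-coordinate oracle *)

Section coordinate_oracle.
Context {R : realType} {n : nat} {I : Type}.
Implicit Types (X : set 'rV[R]_n) (f : 'rV[R]_n -> R) (F : I -> 'rV[R]_n -> R).

Definition first_coordinate_subgradients X f x : set 'rV[R]_n :=
  [set g | exists k a, [/\ g = a *: delta_mx 0 k, coordinate_subgradient X f x k a &
    forall l b, coordinate_subgradient X f x l b -> (k <= l)%N]].

(* [xget] chooses by the extension of the set alone, so that the answer depends
   only on the value at [x] and on the set of coordinate subgradients there. *)
Definition coordinate_oracle X F (i : I) x : R * 'rV[R]_n :=
  (F i x, xget 0 (first_coordinate_subgradients X (F i) x)).

Lemma first_coordinate_subgradients_neq0 X f x :
    (exists k a, coordinate_subgradient X f x k a) ->
  exists g, first_coordinate_subgradients X f x g.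
Proof.
case=> k0 [a0 h0].
pose P m := `[< exists (k : 'I_n) a, k = m :> nat /\ coordinate_subgradient X f x k a >].
have exP : exists m, P m by exists k0; apply/asboolP; exists k0, a0.
case: (ex_minnP exP) => m /asboolP [k [a [km ka]]] mmin.
exists (a *: delta_mx 0 k), k, a; split=> // l b lb.
by rewrite km; apply: mmin; apply/asboolP; exists l, b.
Qed.

Lemma coordinate_oracle_single X F :
    (forall i x, X x -> exists k a, coordinate_subgradient X (F i) x k a) ->
  single_coordinate_oracle X F (coordinate_oracle X F).
Proof.
move=> hF; split=> i x Xx;
  have := xgetPex 0 (first_coordinate_subgradients_neq0 (hF i x Xx));
  case=> k [a [ga ka kmin]].
  by split=> //=; rewrite ga.
by exists k, a.
Qed.

(** By convexity the subgradients at [x] depend only on the function near [x], so [xget] chooses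
    from the same set. *)
Lemma coordinate_oracle_local X F :
    (forall x y t, X x -> X y -> 0 <= t <= 1 -> X (t *: y + (1 - t) *: x)) ->
    (forall i, convex_function X (F i)) ->
  local_oracle X F (coordinate_oracle X F).
Proof.
move=> cX cF i j x Xx ij; rewrite /coordinate_oracle.
have ji : \forall y \near within X (nbhs x), F j y = F i y.
  by apply: filterS ij => y ->.
have -> : F i x = F j x by exact: (nbhs_singleton ij).
congr (_, xget _ _).
have loc i' j' : (\forall y \near within X (nbhs x), F i' y = F j' y) ->
    forall k a, coordinate_subgradient X (F i') x k a ->
      coordinate_subgradient X (F j') x k a.
  by move=> h k a; apply: subgradient_local => // y t Xy; apply: cX.
by apply/seteqP; split=> g [k [a [-> ka kmin]]]; exists k, a; split=> //;
  do ?[exact: (loc _ _ ij)|exact: (loc _ _ ji)] => l b lb; apply: (kmin l b);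
  do ?[exact: (loc _ _ ij)|exact: (loc _ _ ji)].
Qed.

End coordinate_oracle.

Section family_oracle.
Context {R : realType} {n M : nat} (L r : R).
Hypotheses (L0 : 0 < L) (r0 : 0 < r) (n0 : (0 < n)%N).
Implicit Types (i j : {ffun 'I_n -> M.-tuple bool}).
Implicit Types (x y : 'rV[R]_n) (c k l : 'I_n).

Let X : set 'rV[R]_n := box n r.
Local Notation F := (@family R n M L r).
Local Notation pc := (piece L r).
Local Notation mu := (height L r 0 M).
Local Notation oracle := (coordinate_oracle X F).

Let mu0 : 0 <= mu.
Proof. by rewrite mulr_ge0 ?level_ge0 // mulr_ge0 // ltW. Qed.

Lemma active_subgradient i x c : F i x = pc (i c) (x 0 c) ->
  exists a, coordinate_subgradient X (F i) x c a.
Proof.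
move=> Fc; have [a ha] := piece_subgradient L0 r0 (i c) (x 0 c).
exists a; apply/coordinate_subgradientP => y _; rewrite Fc.
exact: le_trans (ha _) (piece_le_family _ _ _ _ _).
Qed.

Lemma family_oracle_single : single_coordinate_oracle X F oracle.
Proof.
apply: coordinate_oracle_single => i x _.
have [c /active_subgradient [a ha]] := family_attained L0 r0 i x n0.
by exists c, a.
Qed.

Lemma family_oracle_local : local_oracle X F oracle.
Proof.
apply: coordinate_oracle_local => [x y t Xx Xy|i]; first exact: box_convex.
exact: family_convex.
Qed.

(* Moving all the other coordinates to their minimisers would otherwise bring
   the function below its value at [x]. *)
Lemma subgradient_active i x k a : X x -> mu < F i x ->
  coordinate_subgradient X (F i) x k a -> pc (i k) (x 0 k) = F i x.
Proof.
move=> Xx mux /coordinate_subgradientP ka.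
have [y Xy ylow] := family_low L0 r0 i.
pose z : 'rV[R]_n := \row_l (if l == k then x 0 l else y 0 l).
have Xz : X z.
  apply: row_norm_le => [|l]; first exact: ltW.
  by rewrite mxE; case: ifP => _; apply: le_trans (coord_norm_le _ _) _.
have := ka z Xz; rewrite mxE eqxx subrr mulr0 addr0 => Fxz.
apply/eqP; rewrite eq_le piece_le_family leNgt; apply/negP => lt_k.
have : F i z < F i x.
  rewrite /family; apply: bigmax_lt => [|l _]; first exact: le_lt_trans mux.
  by rewrite mxE; case: eqP => [->//|_]; apply: le_lt_trans mux.
by rewrite ltNge Fxz.
Qed.

(** Move coordinate [c] slightly towards [y] and put the others at minimisers. The value is then
    that of piece [c] and exceeds [h], where the two instances agree. Convexity of the piece extends
    the inequality to [y]. *)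
Lemma coordinate_subgradient_transfer i j x c (a h : R) : X x ->
    F i x = pc (i c) (x 0 c) -> F j x = pc (j c) (x 0 c) ->
    mu < F i x -> h < F i x ->
    (forall u, Num.max (pc (i c) u) h = Num.max (pc (j c) u) h) ->
    coordinate_subgradient X (F i) x c a ->
  coordinate_subgradient X (F j) x c a.
Proof.
move=> Xx Fi Fj mui hi ij /coordinate_subgradientP ha.
apply/coordinate_subgradientP => y Xy.
have Fij : F j x = F i x.
  rewrite Fj Fi; have := ij (x 0 c); rewrite (max_l (ltW _)) -?Fi // => e.
  by move: e hi; rewrite Fi; case: (leP (pc (j c) (x 0 c)) h) => [_ ->|//]; rewrite ltxx.
set D := y 0 c - x 0 c.
pose K := Num.max h mu; pose gap := F i x - K.
have gap0 : 0 < gap by rewrite subr_gt0 gt_max hi.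
have hK : h <= K by rewrite le_max lexx.
have muK : mu <= K by rewrite le_max lexx orbT.
have aD0 : 0 <= `|a * D| by [].
(* Small enough that the linear lower bound stays above both [h] and [mu]. *)
pose t := gap / (gap + `|a * D|).
have pos : 0 < gap + `|a * D| by rewrite ltr_pwDl.
have t0 : 0 < t by rewrite divr_gt0.
have t1 : 0 <= t <= 1 by rewrite ltW //= ler_pdivrMr // mul1r lerDl.
have tgap : t * `|a * D| < gap.
  rewrite /t mulrAC ltr_pdivrMr // mulrDr.
  by have := mulr_gt0 gap0 gap0; lra.
have high : K < F i x + t * (a * D).
  have := ler_norm (- (t * (a * D))); rewrite normrN normrM (gtr0_norm t0).
  by rewrite /gap in tgap; lra.
have [w Xw wlow] := family_low L0 r0 i.
pose v := t * y 0 c + (1 - t) * x 0 c.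
pose z : 'rV[R]_n := \row_l (if l == c then v else w 0 l).
have Xz : X z.
  apply: row_norm_le => [|l]; first exact: ltW.
  rewrite mxE; case: eqP => [_|_]; last exact: le_trans (coord_norm_le _ _) _.
  have := coord_norm_le (t *: y + (1 - t) *: x) c; rewrite !mxE => hv.
  exact: le_trans hv (box_convex Xy Xx t1).
have Fz := ha z Xz; rewrite mxE eqxx in Fz.
have vD : v - x 0 c = t * D by rewrite /v /D; ring.
rewrite vD (mulrCA a) in Fz.
have Fiz : F i z <= Num.max (pc (i c) v) mu.
  apply: family_le => [|l]; first by rewrite le_max mu0 orbT.
  by rewrite mxE le_max; case: eqP => [->|_]; rewrite ?lexx // wlow orbT.
have iv : F i x + t * (a * D) <= pc (i c) v.
  by move: (le_trans Fz Fiz); rewrite le_max => /orP[//|]; lra.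
have jv : pc (j c) v = pc (i c) v.
  have hv : h < pc (i c) v by lra.
  have := ij v; rewrite (max_l (ltW hv)) => e.
  by move: e hv; case: (leP (pc (j c) v) h) => [_ ->|//]; rewrite ltxx.
have := piece_convex L0 r0 (j c) (y 0 c) (x 0 c) t1; rewrite -/v jv -Fj Fij => cv.
apply: le_trans (_ : pc (j c) (y 0 c) <= _); last exact: piece_le_family.
by rewrite -(ler_pM2l t0); lra.
Qed.

(** The first coordinate with a subgradient is [c] for both instances: [active_subgradient] gives
    one there, [subgradient_active] excludes smaller indices. The slopes at [c] transfer both
    ways. *)
Lemma family_oracle_eq i j x c (h : R) : X x ->
    (forall l, pc (i l) (x 0 l) <= pc (i c) (x 0 c)) ->
    (forall l, pc (i l) (x 0 l) = pc (i c) (x 0 c) -> (c <= l)%N) ->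
    (forall l, pc (j l) (x 0 l) <= pc (j c) (x 0 c)) ->
    (forall l, pc (j l) (x 0 l) = pc (j c) (x 0 c) -> (c <= l)%N) ->
    pc (i c) (x 0 c) = pc (j c) (x 0 c) ->
    mu < pc (i c) (x 0 c) -> h < pc (i c) (x 0 c) ->
    (forall u, Num.max (pc (i c) u) h = Num.max (pc (j c) u) h) ->
  oracle i x = oracle j x.
Proof.
move=> Xx iU imin jU jmin eij mui hi ij.
have Fi : F i x = pc (i c) (x 0 c) by exact: family_eq.
have Fj : F j x = pc (j c) (x 0 c) by exact: family_eq.
rewrite /coordinate_oracle Fi Fj eij; congr (_, xget _ _).
have half i' j' :
    (forall l, pc (i' l) (x 0 l) = pc (i' c) (x 0 c) -> (c <= l)%N) ->
    (forall l, pc (j' l) (x 0 l) = pc (j' c) (x 0 c) -> (c <= l)%N) ->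
    F i' x = pc (i' c) (x 0 c) -> F j' x = pc (j' c) (x 0 c) ->
    mu < F i' x -> mu < F j' x -> h < F i' x ->
    (forall u, Num.max (pc (i' c) u) h = Num.max (pc (j' c) u) h) ->
  first_coordinate_subgradients X (F i') x `<=`
    first_coordinate_subgradients X (F j') x.
  move=> i'min j'min Fi' Fj' mui' muj' hi' ij' g [k [a [-> ka kmin]]].
  have [b /kmin kc] := active_subgradient Fi'.
  have kc' : k = c.
    apply/val_inj/eqP; rewrite eqn_leq kc /=; apply: i'min.
    by rewrite -Fi'; apply: subgradient_active ka.
  rewrite kc' in ka *; exists c, a; split=> //.
    exact: (coordinate_subgradient_transfer Xx Fi' Fj' mui' hi' ij' ka).
  move=> l e le; apply: j'min; rewrite -Fj'; exact: subgradient_active le.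
apply/seteqP; split; apply: half => //; rewrite ?Fi ?Fj -?eij //.
Qed.

End family_oracle.

(** * String guessing *)

Section string_guessing.
Context {R : realType} {V B : Type} {I : finType}.
Variables (X : set V) (O : I -> V -> B) (good : I -> V -> Prop).
Variables (strat : seq B -> action V) (cell : nat -> {set I} -> Prop).

Definition answer_constant (x : V) (S : {set I}) : Prop :=
  {in S &, forall i j, O i x = O j x}.

Definition solved T h i : Prop := exists t x,
  [/\ (t <= T)%N, run strat (O i) h t x & good i x].

Hypothesis strat_in : forall h, X (Defs.point (strat h)).
Hypothesis good_unique : forall i j x, good i x -> good j x -> i = j.
(** One query peels off [S1], where its answer is fixed, and the same query is then applied to [S2];
    [f] counts the unknown bits. *)
Hypothesis cell_split : forall f (S : {set I}) x, cell f S -> X x ->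
  answer_constant x S \/ exists f' (S1 S2 : {set I}),
    [/\ f = f'.+1, S \subset S1 :|: S2, cell f' S1, cell f' S2 & answer_constant x S1].

Lemma run_query_inv s (o : V -> B) h x t y : s h = Query x -> run s o h t y ->
  exists t', t = t'.+1 /\ run s o (rcons h (o x)) t' y.
Proof.
move=> sx r; case: r sx => [h' x' ->//|h' x' t' y' -> r] [xx].
by exists t'; rewrite -xx.
Qed.

Lemma run_output_inv s (o : V -> B) h x t y : s h = Output x -> run s o h t y ->
  t = 0%N /\ y = x.
Proof. by move=> sx r; case: r sx => [h' x' -> [->]|h' x' t' y' ->]. Qed.

Lemma solved_output T h x i : strat h = Output x -> solved T h i -> good i x.
Proof. by move=> sx [t [y [_ /(run_output_inv sx) [_ ->]]]]. Qed.

Lemma solved_query T h x i : strat h = Query x -> solved T h i ->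
  exists2 T', T = T'.+1 & solved T' (rcons h (O i x)) i.
Proof.
move=> sx [t [y [tT /(run_query_inv sx) [t' [tt' r]] gy]]].
by case: T tT => [|T]; rewrite tt' // => tT; exists T => //; exists t', y.
Qed.

(* The weight [3/2] per free bit makes the weights of the pieces cut off a cell
   by one query, which halve at each step, sum to at most 3 times its own. *)
Lemma solved_count T h f (S : {set I}) : cell f S ->
  #|[set i in S | `[< solved T h i >]]|%:R <= 3 ^+ T * (3 / 2) ^+ f :> R.
Proof.
elim: T h f S => [|T IH] h f S cS.
all: have f1 k : 1 <= (3 / 2 : R) ^+ k by rewrite exprn_ege1 //; lra.
all: case sx : (strat h) => [x|x]; last first.
(* An output is good for at most one instance. *)
1,3: apply: (@le_trans _ _ 1); last by rewrite mulr_ege1 // exprn_ege1 // ler1n.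
1,2: rewrite lern1; apply/card_le1_eqP => i j; rewrite !inE.
1,2: move=> /andP[_ /asboolP gi] /andP[_ /asboolP gj].
1,2: exact: good_unique (solved_output sx gj) (solved_output sx gi).
  rewrite eq_card0 => [|i]; first by rewrite mul1r (le_trans _ (f1 _)).
  rewrite !inE; apply/negbTE/negP => /andP[_ /asboolP].
  by case/(solved_query sx).
have Xx : X x by have := strat_in h; rewrite sx.
have constant_case g (S' : {set I}) : cell g S' -> answer_constant x S' ->
    #|[set i in S' | `[< solved T.+1 h i >]]|%:R <= 3 ^+ T * (3 / 2) ^+ g :> R.
  move=> cS' constS'; have [->|[i0 i0S]] := finset.set_0Vmem S'.
    rewrite eq_card0 => [|i]; last by rewrite !inE.
    by rewrite mulr_ge0 ?exprn_ge0 //; lra.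
  apply: le_trans (IH (rcons h (O i0 x)) _ _ cS'); rewrite ler_nat.
  apply/subset_leq_card/fintype.subsetP => i; rewrite !inE.
  move=> /andP[iS /asboolP /(solved_query sx) [_ [<-] sT]].
  by rewrite iS; apply/asboolP; rewrite (constS' i0 i).
(* The inner induction follows the cells peeled off by this one query. Its step is
   [1 + 3 <= 3 * (3/2)]. *)
rewrite exprS -mulrA; elim: f S cS => [|f IHf] S cS.
all: have [constS|[f' [S1 [S2 [ff' SS cS1 cS2 constS]]]]] := cell_split cS Xx.
all: try by [apply: le_trans (constant_case _ _ cS constS) _; rewrite ler_peMl
            ?mulr_ge0 ?exprn_ge0 ?ler1n //; lra].
- by [].
case: ff' => ff'; subst f'.
apply: (@le_trans _ _ (#|[set i in S1 | `[< solved T.+1 h i >]]|%:R +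
                       #|[set i in S2 | `[< solved T.+1 h i >]]|%:R)).
  rewrite -natrD ler_nat; apply: leq_trans (leq_card_setU _ _).1.
  apply/subset_leq_card/fintype.subsetP => i; rewrite !inE => /andP[iS ->].
  by rewrite !andbT; have := fintype.subsetP SS i iS; rewrite inE.
apply: le_trans (lerD (constant_case _ _ cS1 constS) (IHf _ cS2)) _.
rewrite exprS; have : 0 <= 3 ^+ T * (3 / 2) ^+ f :> R.
  by rewrite mulr_ge0 ?exprn_ge0 //; lra.
lra.
Qed.

End string_guessing.

(** * Cells: sets of instances with prescribed prefixes *)

Section cells.
Context {n M : nat}.
Implicit Types (i j : {ffun 'I_n -> M.-tuple bool}) (p : 'I_n -> seq bool).
Implicit Types (c l : 'I_n) (b : bool).

Definition prefix_cell p : {set {ffun 'I_n -> M.-tuple bool}} :=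
  [set i : {ffun 'I_n -> M.-tuple bool} | [forall c, take (size (p c)) (i c) == p c]]%SET.

Definition free_bits p : nat := (\sum_c (M - size (p c)))%N.

Definition extend p c b l : seq bool := if l == c then rcons (p c) b else p l.

Definition is_cell f (S : {set {ffun 'I_n -> M.-tuple bool}}) : Prop :=
  exists p, [/\ forall c, (size (p c) <= M)%N, f = free_bits p & S = prefix_cell p].

Lemma prefix_cellP p i :
  reflect (forall c, take (size (p c)) (i c) = p c) (i \in prefix_cell p).
Proof. by rewrite inE; apply: (iffP forallP) => h c; apply/eqP; have := h c. Qed.

Lemma take_next p c i b : i \in prefix_cell p -> (size (p c) < M)%N ->
  take (size (p c)).+1 (i c) = rcons (p c) (nth false (i c) (size (p c))).
Proof.
by move=> /prefix_cellP ip pc; rewrite (take_nth false) ?size_tuple // ip.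
Qed.

Lemma prefix_cell_extend p c i b : (size (p c) < M)%N ->
  (i \in prefix_cell (extend p c b)) =
  (i \in prefix_cell p) && (nth false (i c) (size (p c)) == b).
Proof.
move=> pc; apply/prefix_cellP/andP => [h|[ip /eqP ib] l].
  have := h c; rewrite /extend eqxx size_rcons (take_nth false) ?size_tuple //.
  case/rcons_inj => hc ->; split=> //; apply/prefix_cellP => l.
  by have := h l; rewrite /extend; case: eqP => [->|].
rewrite /extend; case: eqP => [->|_]; last exact: (prefix_cellP _ _ ip).
by rewrite size_rcons take_next // ib.
Qed.

Lemma extend_size p c b : (size (p c) < M)%N -> (forall l, size (p l) <= M)%N ->
  (forall l, size (extend p c b l) <= M)%N.
Proof. by move=> pc pM l; rewrite /extend; case: eqP => [_|_ //]; rewrite size_rcons. Qed.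

Lemma free_bits_extend p c b : (size (p c) < M)%N ->
  free_bits p = (free_bits (extend p c b)).+1.
Proof.
move=> pc; rewrite /free_bits (bigD1 c) //= [in RHS](bigD1 c) //=.
rewrite /extend eqxx size_rcons -addSn; congr addn; first by lia.
by apply: eq_bigr => l /negbTE ->.
Qed.

(** Supplies a second member of the cell to which [piece_split] applies at the first unknown bit. *)
Lemma flip_next_bit p c i : i \in prefix_cell p -> (size (p c) < M)%N ->
  exists2 j, j \in prefix_cell p &
    take (size (p c)).+1 (i c) <> take (size (p c)).+1 (j c).
Proof.
move=> ip pc; set m := size (p c).
pose t := [tuple (if val k == m then ~~ tnth (i c) k else tnth (i c) k) | k < M].
have tE k : (k < M)%N ->
    nth false t k = if k == m then ~~ nth false (i c) k else nth false (i c) k.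
  by move=> kM; rewrite (nth_mktuple _ _ (Ordinal kM)) /= (tnth_nth false).
pose j : {ffun 'I_n -> M.-tuple bool} := [ffun l => if l == c then t else i l].
have jc : j c = t by rewrite ffunE eqxx.
exists j.
  apply/prefix_cellP => l; rewrite ffunE; case: eqP => [->|_].
    rewrite -[RHS](prefix_cellP _ _ ip) -/m.
    apply: (@eq_from_nth _ false) => [|k]; rewrite !size_take !size_tuple ?pc //.
    by move=> km; rewrite !nth_take // tE ?(ltn_trans km) // ltn_eqF.
  exact: (prefix_cellP _ _ ip).
rewrite jc => /(congr1 (fun s => nth false s m)); rewrite !nth_take // tE //.
by rewrite eqxx; case: nth.
Qed.

Lemma prefix_cell_full p i j : (forall c, size (p c) = M) ->
  i \in prefix_cell p -> j \in prefix_cell p -> i = j.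
Proof.
move=> pM /prefix_cellP ip /prefix_cellP jp; apply/ffunP => c; apply/val_inj => /=.
by have := ip c; rewrite -(jp c) pM !take_oversize ?size_tuple.
Qed.

Lemma is_cell_setT : is_cell (n * M) [set: {ffun 'I_n -> M.-tuple bool}]%SET.
Proof.
exists (fun=> [::]); split=> //; first by rewrite /free_bits sum_nat_const card_ord subn0.
by apply/finset.setP => i; rewrite inE; symmetry; apply/prefix_cellP => c; rewrite take0.
Qed.

End cells.

(** * How one query splits a cell *)

Section one_query.
Context {R : realType} {n M : nat} (L r : R).
Hypotheses (L0 : 0 < L) (r0 : 0 < r) (n0 : (0 < n)%N).
Local Notation X := (@box R n r).
Local Notation F := (@family R n M L r).
Local Notation pc := (piece L r).
Local Notation oracle := (coordinate_oracle X F).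

(* Let [U] be the largest value at [x] over the cell and [c] the first coordinate
   attaining it for some instance of the cell. Fixing the next bit of [c] to that of
   a maximiser forces the value [U] and the coordinate [c] in the answer. *)
Lemma family_cell_split f S x : is_cell f S -> X x ->
  answer_constant oracle x S \/
  exists f' (S1 S2 : {set {ffun 'I_n -> M.-tuple bool}}),
    [/\ f = f'.+1, S \subset S1 :|: S2, is_cell f' S1, is_cell f' S2 &
        answer_constant oracle x S1].
Proof.
case=> p [pM -> ->] Xx {f S}; set S := prefix_cell p.
case: (boolP [forall c, size (p c) == M]) => [/forallP full|].
  left=> i j iS jS; rewrite (@prefix_cell_full _ _ p i j) // => c; exact/eqP.
rewrite negb_forall => /existsP [c1 pc1].
have {}pc1 : (size (p c1) < M)%N by rewrite ltn_neqAle pc1 pM.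
have [S0|[i0 i0S]] := finset.set_0Vmem S; first by left=> i j; rewrite S0 inE.
have [imax imaxS Fmax] : exists2 i, i \in S & forall j, j \in S -> F j x <= F i x.
  by case: (arg_maxP (fun i => F i x) i0S) => i iS h; exists i.
set U := F imax x in Fmax.
have [cmax cmaxU] := family_attained L0 r0 imax x n0.
have le_U i l : i \in S -> pc (i l) (x 0 l) <= U.
  by move=> iS; apply: le_trans (Fmax i iS); apply: piece_le_family.
pose P l := [exists i in S, pc (i l) (x 0 l) == U].
have Pcmax : P cmax by apply/existsP; exists imax; rewrite imaxS -cmaxU /=.
have [c /existsP [s /andP[sS /eqP sU]] cmin] := arg_minnP (fun l : 'I_n => l : nat) Pcmax.
have first_c i l : i \in S -> pc (i l) (x 0 l) = U -> (c <= l)%N.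
  by move=> iS iU; apply: cmin; apply/existsP; exists i; rewrite iS iU /=.
(* Two members of the cell differing at the next bit of [l] cannot both be low at [x]. *)
have U_ge l : (size (p l) < M)%N -> height L r (3 / 2) (size (p l)).+1 <= U.
  move=> pl; have [j jS ij] := flip_next_bit i0S pl.
  apply: le_trans (_ : Num.max (pc (i0 l) (x 0 l)) (pc (j l) (x 0 l)) <= _).
    by apply: piece_split => //; rewrite size_tuple.
  by rewrite ge_max !le_U.
have muU : height L r 0 M < U by apply: lt_le_trans (U_ge _ pc1); apply: height_mu.
(* Agreement of the pieces of [c] with that of [s] above some [h < U] already fixes the answer. *)
have answers (h : R) (S' : {set {ffun 'I_n -> M.-tuple bool}}) : h < U ->
    {subset S' <= S} ->
    (forall i u, i \in S' -> Num.max (pc (i c) u) h = Num.max (pc (s c) u) h) ->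
    answer_constant oracle x S'.
  move=> hU S'S S'h.
  have S'U i : i \in S' -> pc (i c) (x 0 c) = U.
    move=> iS'; have := S'h i (x 0 c) iS'; rewrite sU (max_l (ltW hU)) => e.
    by move: e hU; case: (leP (pc (i c) (x 0 c)) h) => [_ ->|//]; rewrite ltxx.
  move=> i j iS' jS'; apply: (family_oracle_eq L0 r0 (c := c) (h := h)) => //;
    rewrite ?S'U // => l; do ?[exact/le_U/S'S|exact/first_c/S'S].
  by rewrite !S'h.
have [pc_full|pc_free] := leqP M (size (p c)).
  left; apply: (answers (height L r 0 M)) => // i u iS.
  have pcM : size (p c) = M by apply/eqP; rewrite eqn_leq pM.
  have := prefix_cellP _ _ iS c; rewrite -(prefix_cellP _ _ sS c) pcM.
  by rewrite !take_oversize ?size_tuple // => ->.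
right; set b := nth false (s c) (size (p c)).
exists (free_bits (M := M) (extend p c b)), (prefix_cell (extend p c b)),
  (prefix_cell (extend p c (~~ b))); split.
- exact: free_bits_extend.
- apply/fintype.subsetP => i iS; rewrite finset.in_setU !prefix_cell_extend // -/S iS /=.
  by case: nth; case: b.
- by exists (extend p c b); split=> //; apply: extend_size.
- exists (extend p c (~~ b)); split=> //; first exact: extend_size.
  by have := free_bits_extend b pc_free; rewrite (free_bits_extend (~~ b) pc_free) => -[].
- apply: (answers (height L r 1 (size (p c)).+1)).
  + apply: lt_le_trans (U_ge c pc_free).
    by rewrite /height ltr_pM2l ?mulr_gt0 //; apply: level_lt; lra.
  + by move=> i; rewrite prefix_cell_extend // => /andP[].
  + move=> i u; rewrite prefix_cell_extend // => /andP[iS /eqP ib].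
    apply: piece_prefix; rewrite ?size_tuple //.
    by rewrite !take_next // ib.
Qed.

End one_query.

(** * Randomised algorithms *)

Section sum_of_probabilities.
Context {d : measure_display} {Om : measurableType d} {R : realType}.
Context (P : probability Om R) {I : finType}.
Local Open Scope ereal_scope.

(** The sum is the expected number of events that occur, and this number is almost surely at most
    [b]. *)
Lemma sum_probability_le (E : I -> set Om) (b : R) : (0 <= b)%R ->
    (forall i, measurable (E i)) ->
    {ae P, forall w, (#|[set i | w \in E i]%SET|%:R <= b)%R} ->
  \sum_i P (E i) <= b%:E.
Proof.
move=> b0 mE hb.
have -> : \sum_i P (E i) = \int[P]_w (\sum_i (\1_(E i) w)%:E).
  rewrite ge0_integral_sum //.
  - by apply: eq_bigr => i _; rewrite integral_indic // setIT.
  - by move=> i; apply/measurable_EFinP; exact: measurable_indic.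
apply: (@le_trans _ _ (\int[P]_w (b%:E))); last first.
  rewrite integral_cst // -[leRHS]mule1.
  by apply: lee_wpmul2l; rewrite ?lee_fin //; exact: probability_le1.
apply: ae_ge0_le_integral => //.
- by move=> w _; apply: sume_ge0.
- by apply: emeasurable_sum => i; apply/measurable_EFinP; exact: measurable_indic.
- apply: filterS hb => w h _; rewrite sumEFin lee_fin.
  apply: le_trans h; rewrite -sum1_card natr_sum [leRHS]big_mkcond /=.
  by apply: ler_sum => i _; rewrite inE indicE; case: (_ \in _).
Qed.

End sum_of_probabilities.

Section measurability.
Context {R : realType} {I : finType} {V B : Type} {X : set V} {O : I -> V -> B}.
Context {d : measure_display} {Om : measurableType d} {P : probability Om R}.
Variable A : algorithm X O P.

Lemma measurable_queries_in i (Q : set nat) : measurable [set w | Q (queries A i w)].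
Proof.
by rewrite -[X in measurable X]setTI; apply: (measurable_queries A i).
Qed.

End measurability.

Section randomised_bounds.
Context {R : realType} {I : finType} {n : nat} {B : Type}.
Context {X : set 'rV[R]_n} {O : I -> 'rV[R]_n -> B}.
Context {d : measure_display} {Om : measurableType d} {P : probability Om R}.
Variables (A : algorithm X O P) (F : I -> 'rV[R]_n -> R) (e : R).
Local Open Scope ereal_scope.

(** A success uses more than [T] queries or is counted by [b], a bound valid for every value of the
    private randomness. *)
Lemma error_bound_queries (Pe b : R) (T : nat) : (0 <= b)%R ->
    (forall s : seq B -> action 'rV[R]_n, (forall h, X (Defs.point (s h))) ->
      (#|[set i | `[< solved O (fun i => eps_minimum X (F i) e) s T [::] i >]]%SET|%:R <= b)%R) ->
    error_bound A F e Pe ->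
  (1 - Pe - b / #|I|%:R)%:E <=
    uniform_mean (fun i => P [set w | (T < queries A i w)%N]).
Proof.
move=> b0 count [mS success_ge].
pose Q i := [set w | (T < queries A i w)%N].
have mQ i : measurable (Q i) by exact: (measurable_queries_in A i [set q | (T < q)%N]).
rewrite EFinB leeBlDr //; apply: le_trans success_ge _.
have fast : \sum_i P (success A F e i `\` Q i) <= b%:E.
  apply: sum_probability_le => // [i|]; first exact: measurableD.
  have : {ae P, forall w i, run (strategy A w) (O i) [::] (queries A i w) (output A i w)}.
    by apply: filter_forall => i; exact: runP.
  apply: filterS => w runs; apply: le_trans (count (strategy A w) (strategy_in A w)).
  rewrite ler_nat; apply/subset_leq_card/fintype.subsetP => i; rewrite !inE.
  move=> [good /negP]; rewrite -leqNgt => fast.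
  by exists (queries A i w), (output A i w).
have I0 : 0 <= (#|I|%:R^-1 : R)%:E by rewrite lee_fin invr_ge0.
rewrite /uniform_mean (mulrC b) EFinM -muleDr //; last first.
  by apply: ge0_adde_def; rewrite inE ?sume_ge0 // lee_fin.
apply: lee_wpmul2l => //; apply: le_trans (leeD (lexx _) fast).
rewrite -big_split /=; apply: lee_sum => i _.
have mSQ : measurable (success A F e i `\` Q i) by exact: measurableD.
apply: le_trans (measureU2 P (mQ i) mSQ).
apply: le_measure; rewrite ?inE //; first exact: measurableU.
by move=> w Sw; have [Qw|nQw] := pselect (Q i w); [left|right].
Qed.

(** Markov's inequality, averaged over the instances. *)
Lemma prob_queries_ge_expected t : (0 <= t)%R ->
  t%:E * prob_queries_ge A t <= expected_queries A.
Proof.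
move=> t0; rewrite /prob_queries_ge /expected_queries /uniform_mean muleCA.
apply: lee_wpmul2l; first by rewrite lee_fin invr_ge0.
rewrite ge0_sume_distrr //; apply: lee_sum => i _.
have mq : measurable [set w | (t <= (queries A i w)%:R)%R].
  exact: (measurable_queries_in A i [set q | (t <= q%:R)%R]).
have mf : measurable_fun setT (fun w => ((queries A i w)%:R : R)%:E).
  apply/measurable_EFinP.
  by apply: (measurableT_comp (f := fun q : nat => q%:R : R)) => //;
    exact: measurable_queries.
rewrite -integral_cst //.
apply: (@le_trans _ _ (\int[P]_(w in [set w | (t <= (queries A i w)%:R)%R])
    ((queries A i w)%:R)%:E)).
  apply: ge0_le_integral => //; last exact: measurable_funS mf.
apply: ge0_subset_integral => //.
Qed.

End randomised_bounds.

(** * Separation of minima and numerical estimates *)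

Section family_minima.
Context {R : realType} {n M : nat} (L r e : R).
Hypotheses (L0 : 0 < L) (r0 : 0 < r) (eM : e * 16 ^+ M <= L * r).

(** An [e]-minimum has value below [height L r 0 M + e], which [eM] keeps under the height of
    [family_split]. *)
Lemma family_minimum_unique (i j : {ffun 'I_n -> M.-tuple bool}) (x : 'rV[R]_n) :
    eps_minimum (box n r) (family L r i) e x ->
    eps_minimum (box n r) (family L r j) e x -> i = j.
Proof.
have mu0 : 0 <= height L r 0 M.
  by rewrite mulr_ge0 ?level_ge0 // ltW // mulr_gt0.
have low (k : {ffun 'I_n -> M.-tuple bool}) : eps_minimum (box n r) (family L r k) e x ->
    family L r k x < height L r 0 M + e.
  case=> _ [y [_ ymin xy]]; apply: lt_le_trans xy _; rewrite lerD2r.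
  have [z Xz zlow] := family_low L0 r0 k.
  apply: le_trans (ymin z Xz) _; exact: (family_le mu0 zlow).
move=> /low xi /low xj; apply: contrapT => /(family_split L0 r0 x).
rewrite leNgt gt_max => /negP; apply.
have gap : height L r 0 M + e <= height L r (3 / 2) M.
  rewrite -lerBrDl /height -mulrBr levelB subr0 mulrA ler_pdivlMr ?exprn_gt0 //.
  by apply: le_trans eM _; rewrite ler_peMr ?(ltW (mulr_gt0 L0 r0)) //; lra.
by rewrite !(lt_le_trans _ gap).
Qed.

End family_minima.

Section solved_fraction.
Context {R : realType} {n M : nat}.
Local Notation inst := {ffun 'I_n -> M.-tuple bool}.

Lemma card_instances : #|{: inst}| = (2 ^ (n * M))%N.
Proof. by rewrite card_ffun card_ord card_tuple card_bool -expnM mulnC. Qed.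

Lemma bernoulli_ineq (x : R) m : 0 <= x -> 1 + m%:R * x <= (1 + x) ^+ m.
Proof.
move=> x0; elim: m => [|m IH]; first by rewrite mul0r addr0.
rewrite exprS; have := ler_wpM2l (_ : 0 <= 1 + x) IH; rewrite -natr1 => H.
have := H (addr_ge0 ler01 x0); have : 0 <= m%:R * x * x.
  by rewrite !mulr_ge0.
lra.
Qed.

(* Eight unknown bits pay for one query: [3 <= (7 / 6) ^+ 8]. *)
Lemma solved_fraction_le (T : nat) : (0 < n * M)%N -> (8 * T <= n * M)%N ->
  3 ^+ T * (3 / 2) ^+ (n * M) / #|{: inst}|%:R <= 7 / (n * M)%:R :> R.
Proof.
rewrite card_instances; set K := (n * M)%N => K0 TK.
rewrite natrX -mulrA -expr_div_n.
apply: (@le_trans _ _ ((7 / 6) ^+ K * (3 / 2 / 2) ^+ K)).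
  have half : 0 <= 3 / 2 / 2 :> R by lra.
  rewrite ler_wpM2r ?exprn_ge0 //.
  apply: (@le_trans _ _ ((7 / 6) ^+ (8 * T))).
    have three : 3 <= (7 / 6) ^+ 8 :> R.
      by rewrite !exprS expr0; lra.
    by rewrite exprM lerXn2r ?nnegrE ?exprn_ge0 // (le_trans _ three).
  by rewrite ler_eXn2l //; lra.
(* The base is [7/8], and Bernoulli's inequality for its inverse [1 + 1/7] gives [7 / K]. *)
rewrite -exprMn (_ : 7 / 6 * (3 / 2 / 2) = (1 + 7^-1)^-1 :> R); last by field.
have := @bernoulli_ineq 7^-1 K; rewrite invr_ge0 ler0n => /(_ isT) h.
have K0' : 0 < K%:R :> R by rewrite ltr0n.
rewrite exprVn -[leRHS]invf_div lef_pV2 ?posrE ?divr_gt0 ?exprn_gt0 //; lra.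
Qed.

End solved_fraction.

(** [M] is the integer part of [log_16 q]; as [M >= 1], [q < 2^(4 (M + 1)) <= 2^(8 M)]. The
    assumption on [q] sits under the existential because the family is needed for every [e]. *)
Lemma depth_exists {R : realType} (q : R) : exists M : nat, 16 <= q ->
  [/\ (0 < M)%N, 16 ^+ M <= q & log2 q <= 8 * M%:R].
Proof.
exists (trunc_log 16 (Num.Def.trunc q)) => q16; set M := trunc_log _ _.
have q0 : 0 <= q by lra.
have /andP[lo hi] := truncn_itv q0.
have tr16 : (16 <= Num.Def.trunc q)%N.
  by rewrite -ltnS -(ltr_nat R); apply: le_lt_trans hi.
have /andP[Mlo Mhi] := trunc_log_bounds (isT : (1 < 16)%N) (leq_trans (isT : (0 < 16)%N) tr16).
have M0 : (0 < M)%N by rewrite trunc_log_gt0.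
split=> //.
  by apply: le_trans lo; rewrite -natrX ler_nat.
have qlt : q <= 2 ^+ (4 * M.+1).
  by apply: le_trans (ltW hi) _; rewrite exprM -!natrX ler_nat.
have ln2 : 0 < ln 2 :> R by apply: ln_gt0; lra.
rewrite /log2 ler_pdivrMr //.
apply: le_trans (_ : ln (2 ^+ (4 * M.+1)) <= _).
  by rewrite ler_ln ?posrE ?exprn_gt0 //; lra.
rewrite lnXn // -(mulr_natl (ln 2)) ler_pM2r // -natrM ler_nat; lia.
Qed.

(** The lower bound on [N] makes [56 / N] at most half of [1 - Pe]. *)
Lemma expected_queries_constant {R : realType} (N Pe : R) :
    0 < N -> Pe < 1 -> 112 / (1 - Pe) <= N ->
  1 / 128 * (1 - Pe) * N <= N / 64 * (1 - Pe - 56 * N^-1).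
Proof.
move=> N0 Pe1; have Pe1' : 0 < 1 - Pe by lra.
rewrite ler_pdivrMr // => h.
have -> : N / 64 * (1 - Pe - 56 * N^-1) = N * (1 - Pe) / 64 - 7 / 8.
  by field; rewrite gt_eqF.
lra.
Qed.

(* c and C are the universal constants, the bounds being asserted for
   C <= L r / e; t0 Pe is the point from which on the distributional bound
   holds, and eta Pe is the o(1) of the high-probability bound. *)
Theorem mainTheorem4 (R : realType) :
  exists (c C : R) (t0 : R -> R) (eta : R -> R -> R),
    0 < c /\
    (forall Pe : R, 0 <= Pe < 1 -> eta Pe t @[t --> +oo] --> 0) /\
    forall (n : nat) (L r e : R), (0 < n)%N -> 0 < L -> 0 < r -> 0 < e ->
    exists (I : finType) (F : I -> 'rV[R]_n -> R)
           (O : I -> 'rV[R]_n -> R * 'rV[R]_n),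
      let X := box n r in
      let N := n%:R * log2 (L * r / e) in
      [/\ (0 < #|I|)%N,
          distinct_on X F,
          forall i, convex_function X (F i),
          forall i, L.-lipschitz_X (F i : 'rV[R]_n -> R^o) &
          [/\ single_coordinate_oracle X F O,
              local_oracle X F O &
              C <= L * r / e ->
              forall (Pe : R), 0 <= Pe < 1 ->
              forall (d : measure_display) (Om : measurableType d)
                     (P : probability Om R) (A : algorithm X O P),
                error_bound A F e Pe ->
                (t0 Pe <= N ->
                   ((c * (1 - Pe) * N)%:E <= expected_queries A)%E) /\
                ((1 - Pe - eta Pe N)%:E <= prob_queries_ge A (c * N))%E]].
Proof.
(* [1/64] comes from eight bits per query and [N <= 8 n M], and Markov's inequality costs another
   factor 2. [56 = 7 * 8] turns the fraction [7 / (n M)] into a bound in [N], and [16] ensures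
   [M >= 1]. *)
exists (1 / 128), 16, (fun Pe => 112 / (1 - Pe)), (fun _ N => 56 * N^-1).
split; first lra.
split=> [Pe _|n L r e n0 L0 r0 e0].
  rewrite -[X in _ --> X](mulr0 56); apply: cvgM; first exact: cvg_cst.
  by apply/(@gtr0_cvgV0 R R _ _ id) => //; exact: nbhs_pinfty_gt.
have [M hM] := depth_exists (L * r / e).
pose X := box n r : set 'rV[R]_n.
exists {ffun 'I_n -> M.-tuple bool}, (@family R n M L r),
  (coordinate_oracle X (@family R n M L r)) => /=.
set N := n%:R * _.
split.
- by rewrite card_instances expn_gt0.
- exact: family_distinct.
- by move=> i; apply: family_convex.
- by move=> i [x y] /= _; apply: family_lipschitz.
split; [exact: family_oracle_single|exact: family_oracle_local|].
move=> /hM [M0 M_le log_le] Pe /andP[Pe0 Pe1] d Om P A err.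
set K := (n * M)%N.
have K0 : (0 < K)%N by rewrite muln_gt0 n0.
have q16 : 1 < L * r / e.
  by apply: lt_le_trans M_le; rewrite exprn_egt1 ?gtn_eqF //; lra.
have N0 : 0 < N.
  by rewrite mulr_gt0 ?ltr0n // divr_gt0 // ln_gt0 //; lra.
have N64 : 0 <= N / 64 by lra.
have N128 : 1 / 128 * N <= N / 64 by lra.
have NK : N <= 8 * K%:R.
  by rewrite natrM mulrCA ler_pM2l ?ltr0n.
(* With this rounding [8 T <= n M], while more than [T] queries means at least [N / 64]. *)
pose T := Num.Def.trunc (N / 64).
have /andP[Tlo Thi] : (T%:R <= N / 64 < T.+1%:R) by apply: truncn_itv; lra.
have TK : (8 * T <= K)%N by rewrite -(ler_nat R) natrM; lra.
have count (s : seq (R * 'rV[R]_n) -> action 'rV[R]_n) : (forall h, X (Defs.point (s h))) ->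
    #|[set i | `[< solved (coordinate_oracle X (@family R n M L r))
       (fun i => eps_minimum X (family L r i) e) s T [::] i >]]%SET|%:R <=
    3 ^+ T * (3 / 2) ^+ K :> R.
  move=> sX.
  have unique (i j : {ffun 'I_n -> M.-tuple bool}) x :
      eps_minimum X (family L r i) e x -> eps_minimum X (family L r j) e x -> i = j.
    by apply: family_minimum_unique => //; rewrite mulrC -ler_pdivlMr.
  have := solved_count (R := R) sX unique
    (@family_cell_split R n M L r L0 r0 n0) T [::] is_cell_setT.
  apply: le_trans; rewrite ler_nat; apply/subset_leq_card/fintype.subsetP => i.
  by rewrite !inE.
have b0 : 0 <= 3 ^+ T * (3 / 2) ^+ K :> R by rewrite mulr_ge0 ?exprn_ge0.
have prob : ((1 - Pe - 56 * N^-1)%:E <= prob_queries_ge A (N / 64))%E.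
  apply: le_trans (le_trans (error_bound_queries b0 count err) _).
    rewrite lee_fin lerD2l lerN2; apply: le_trans (solved_fraction_le K0 TK) _.
    rewrite ler_pdivrMr ?ltr0n // mulrAC ler_pdivlMr //.
    by rewrite (_ : 56 = 7 * 8 :> R) -?mulrA ?ler_pM2l //; ring.
  rewrite /prob_queries_ge /uniform_mean.
  apply: lee_wpmul2l; first by rewrite lee_fin invr_ge0.
  apply: lee_sum => i _; apply: le_measure; rewrite ?inE.
  - exact: (measurable_queries_in A i [set q | (T < q)%N]).
  - exact: (measurable_queries_in A i [set q | (N / 64 <= q%:R)%R]).
  - by move=> w /= Tq; apply: le_trans (ltW Thi) _; rewrite ler_nat.
split=> [t0N|].
  apply: le_trans (prob_queries_ge_expected A N64).
  apply: le_trans (lee_wpmul2l _ prob); last by rewrite lee_fin.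
  rewrite -EFinM lee_fin.
  exact: expected_queries_constant.
apply: le_trans prob _; rewrite /prob_queries_ge /uniform_mean.
apply: lee_wpmul2l; first by rewrite lee_fin invr_ge0.
apply: lee_sum => i _; apply: le_measure; rewrite ?inE.
- exact: (measurable_queries_in A i [set q | (N / 64 <= q%:R)%R]).
- exact: (measurable_queries_in A i [set q | (1 / 128 * N <= q%:R)%R]).
- by move=> w /=; apply: le_trans.
Qed.
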